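(* Let $0<\delta<1$ and let $f(X)=N(N-1)\sum_{i=1}^{\ell}\beta_i\,t(H_i,X)$ be a subgraph-counting function. Then there exists a constant $C_\delta>0$, depending on $\delta$, the graphs $H_i$ and the weights $\beta_i$ but otherwise independent of $N$, such that for every $X\in\mathcal X_f$ there exists a block matrix $X^*$ with at most $C_\delta$ communities satisfying $$\|X-X^*\|_1\le \delta n+5000\,C_{\boldsymbol\beta}^2\,n^{15/16}.$$
   Context: Fix an integer $N\ge2$, $n=\binom N2$. Vectors $X\in[0,1]^n$ are identified with symmetric $N\times N$ matrices with zero diagonal, entries indexed by unordered pairs $\{i,j\}$, $i\ne j$. For a finite simple graph $H$ on $[m]$, $t(H,X)=\frac{1}{N(N-1)\cdots(N-m+1)}\sum_{q}\prod_{\{l,l'\}\in E(H)}X_{q_lq_{l'}}$, summing over injective $q:[m]\to[N]$. For an edge index $e$, $\partial_ef(X)=\frac12(f(X^{e\leftarrow1})-f(X^{e\leftarrow0}))$ ($X^{e\leftarrow a}$: coordinate $e$ replaced by $a$), $\nabla f(X)=(\partial_ef(X))_e$. $\mathbf 1$ is the matrix with zero diagonal and off-diagonal entries $1$; $\tanh$ acts entrywise; $\|\cdot\|_1$ is the entrywise $\ell^1$ norm. $C_{\boldsymbol\beta}=\max\{12\sum_i|\beta_i||E(H_i)|^2,2\}$ and $\mathcal X_f=\{X\in[0,1]^n:\|X-\frac{\mathbf 1+\tanh(\nabla f(X))}{2}\|_1\le5000C_{\boldsymbol\beta}^2n^{15/16}\}$. A symmetric matrix $X^*\in\mathbb R^{N\times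 N}$ is a block matrix with $k$ communities if there exist a symmetric $P\in\mathbb R^{k\times k}$ and a partition of $[N]$ into disjoint sets $V_1,\dots,V_k$ (the communities) such that $X^*_{ij}=P_{\ell_1\ell_2}$ whenever $i\in V_{\ell_1}$, $j\in V_{\ell_2}$. *)

(* Defs.v *)
From HB Require Import structures.
From mathcomp Require Import all_boot all_order all_algebra.
From mathcomp Require Import all_classical all_reals all_analysis.
Set Implicit Arguments. Unset Strict Implicit. Unset Printing Implicit Defensive.
Import Order.TTheory GRing.Theory Num.Theory.
Local Open Scope ring_scope.

Record sgraph := SGraph {
  gm : nat;
  gadj : rel 'I_gm;
  gadj_sym : symmetric gadj;
  gadj_irr : irreflexive gadj }.
Arguments gadj : clear implicits.

Definition nedges (H : sgraph) : nat :=
  #|[set p : 'I_(gm H) * 'I_(gm H) | (p.1 < p.2)%N && gadj H p.1 p.2]|.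

Section Defs.
Variable R : realType.

Definition tanhR (x : R) : R := (expR x - expR (- x)) / (expR x + expR (- x)).

(* X is in [0,1]^n, n = binom N 2: symmetric, zero diagonal, entries in [0,1]. *)
Definition in_cube (N : nat) (X : 'M[R]_N) : Prop :=
  (forall i j, X i j = X j i) /\ (forall i, X i i = 0) /\
  (forall i j, 0 <= X i j <= 1).

Definition tdens (N : nat) (H : sgraph) (X : 'M[R]_N) : R :=
  (\sum_(q : {ffun 'I_(gm H) -> 'I_N} | injectiveb q)
     \prod_(l : 'I_(gm H)) \prod_(l' : 'I_(gm H) | (l < l')%N && gadj H l l')
        X (q l) (q l')) / (N ^_ (gm H))%:R.

Definition fcount (l : nat) (Hs : 'I_l -> sgraph) (beta : 'I_l -> R)
  (N : nat) (X : 'M[R]_N) : R :=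
  (N * N.-1)%:R * \sum_(i < l) beta i * tdens (Hs i) X.

Definition upd (N : nat) (X : 'M[R]_N) (i j : 'I_N) (a : R) : 'M[R]_N :=
  \matrix_(k, k') if ((k == i) && (k' == j)) || ((k == j) && (k' == i))
                  then a else X k k'.

Definition dpart (N : nat) (f : 'M[R]_N -> R) (X : 'M[R]_N) (i j : 'I_N) : R :=
  (f (upd X i j 1) - f (upd X i j 0)) / 2.

Definition l1pairs (N : nat) (Y : 'M[R]_N) : R :=
  \sum_(i : 'I_N) \sum_(j : 'I_N | (i < j)%N) `|Y i j|.

Definition Cbeta (l : nat) (Hs : 'I_l -> sgraph) (beta : 'I_l -> R) : R :=
  Num.max (12 * \sum_(i < l) `|beta i| * ((nedges (Hs i)) ^ 2)%:R) 2.

Definition nN (N : nat) : R := ('C(N, 2))%:R.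

Definition in_Xf (l : nat) (Hs : 'I_l -> sgraph) (beta : 'I_l -> R)
  (N : nat) (X : 'M[R]_N) : Prop :=
  in_cube X /\
  \sum_(i : 'I_N) \sum_(j : 'I_N | (i < j)%N)
     `|X i j - (1 + tanhR (dpart (@fcount l Hs beta N) X i j)) / 2|
  <= 5000 * Cbeta Hs beta ^+ 2 * powR (nN N) (15%:R / 16%:R).

(* X* is a block matrix with k communities: a symmetric P (k x k) and a
   partition of [N] into k (labelled) disjoint sets V_1..V_k, given by the
   community-label map c, with X*_{ij} = P_{c i, c j}. *)
Definition block_matrix (N k : nat) (Xs : 'M[R]_N) : Prop :=
  exists (P : 'M[R]_k) (c : 'I_N -> 'I_k),
    (forall a b, P a b = P b a) /\ (forall i j, Xs i j = P (c i) (c j)).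

End Defs.

(* Main.v *)
(* Each entry of the gradient of a subgraph count is, up to bounded factors, a
   finite sum over the edges of the graphs of averages over maps [r : [m] -> [N]]
   of products [u_r(i) v_r(j)] with values in [0, 1].  By Maurey's empirical
   method such an average is L2-close to the mean of boundedly many of these
   rank-one terms, whatever the size of [N]; rounding the finitely many factors
   to a grid makes it a block matrix.  Since tanh is Lipschitz, the matrix
   [(1 + tanh (grad f)) / 2] is close to a block matrix, and [X] is close to it
   by definition of [X_f]. *)

Require Import Defs.
From HB Require Import structures.
From mathcomp Require Import all_boot all_order all_algebra.
From mathcomp Require Import all_classical all_reals all_analysis.
From mathcomp Require Import ring lra zify.
Import Order.TTheory GRing.Theory Num.Theory.
Local Open Scope ring_scope.

Section BlockApproximation.
Set Implicit Arguments. Unset Strict Implicit.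
Variable R : realType.

(** * Lipschitz bound for tanh *)

Lemma tanhR_lipschitz (x y : R) : `|tanhR x - tanhR y| <= 4 * `|x - y|.
Proof.
have tanhE (z : R) : tanhR z = 1 - 2 / (expR (z *+ 2) + 1).
  rewrite /tanhR expRN mulr2n expRD; have ez := expR_gt0 z.
  by field; rewrite !gt_eqF // addr_gt0 // mulr_gt0.
wlog yx : x y / y <= x => [th|].
  have [/th //|/ltW/th] := leP y x.
  by rewrite distrC [`|y - x|]distrC.
rewrite !tanhE [`|x - y|]ger0_norm ?subr_ge0 //.
set a := expR (x *+ 2); set b := expR (y *+ 2).
have a0 : 0 < a by exact: expR_gt0.
have b0 : 0 < b by exact: expR_gt0.
have bE : b = a * expR ((y - x) *+ 2).
  by rewrite /b /a -expRD -mulrnDl addrC subrK.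
have ba : b <= a by rewrite ler_expR lerMn2r.
(* This is [1 + t <= expR t] at [t = 2 (y - x)]. Together with [a <= (a + 1) (b + 1)] it gives the
   Lipschitz bound, with the non-optimal constant 4. *)
have le_ab : a - b <= a * ((x - y) *+ 2).
  have := expR_ge1Dx ((y - x) *+ 2); rewrite -(ler_pM2l a0) -bE.
  by lra.
rewrite (_ : _ - _ = 2 * ((a - b) / ((a + 1) * (b + 1)))); last first.
  by field; rewrite !gt_eqF ?addr_gt0.
have q0 : 0 <= (a - b) / ((a + 1) * (b + 1)).
  by rewrite divr_ge0 ?subr_ge0 // mulr_ge0 // addr_ge0 // ltW.
rewrite ger0_norm; last exact: mulr_ge0.
suff : (a - b) / ((a + 1) * (b + 1)) <= (x - y) *+ 2 by lra.
rewrite ler_pdivrMr ?mulr_gt0 ?addr_gt0 //.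
apply: (le_trans le_ab); rewrite mulrC ler_wpM2l //; first lra.
by nra.
Qed.

(** * Averages of rank-one matrices are close to step matrices *)

Lemma exists_le_mean (Q : finType) (F : Q -> R) : (0 < #|Q|)%N ->
  exists q, F q *+ #|Q| <= \sum_q F q.
Proof.
move=> /card_gt0P[q0 _]; pose q := [arg min_(i < q0) F i]%O.
exists q; rewrite -sumr_const; apply: ler_sum => i _.
by rewrite /q; case: arg_minP => // j _; apply.
Qed.

(* Maurey's argument, derandomised: the cross term has mean zero over [q], so
   the next sample can be chosen to increase the squared norm by at most
   [#|I|]. *)
Lemma exists_sample (Q I : finType) (z : Q -> I -> R) (g : I -> R) :
  (0 < #|Q|)%N ->
  (forall i, g i = (\sum_q z q i) / #|Q|%:R) ->
  (forall q i, `|z q i - g i| <= 1) ->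
  forall s, exists qs : 'I_s -> Q,
    \sum_i (\sum_t (z (qs t) i - g i)) ^+ 2 <= (s * #|I|)%:R.
Proof.
move=> Q0 gE zg; elim=> [|s [qs IH]].
  have [q _] := card_gt0P Q0.
  exists (fun _ => q); rewrite big1 // => i _.
  by rewrite big_ord0 expr0n.
pose S i := \sum_t (z (qs t) i - g i).
have [q Hq] := exists_le_mean (fun q => \sum_i S i * (z q i - g i)) Q0.
have mean0 : \sum_q \sum_i S i * (z q i - g i) = 0.
  rewrite exchange_big big1 // => i _ /=.
  rewrite -mulr_sumr sumrB sumr_const gE -[X in _ - X]mulr_natr divfK ?subrr ?mulr0 //.
  by rewrite pnatr_eq0 -lt0n.
have {mean0}Hq : \sum_i S i * (z q i - g i) <= 0.
  by move: Hq; rewrite mean0 -mulr_natr pmulr_lle0 // ltr0n.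
(* The new sample takes index 0 and the earlier ones are shifted by one. *)
exists (fun t => oapp qs q (unlift ord0 t)).
have -> : \sum_i (\sum_t (z (oapp qs q (unlift ord0 t)) i - g i)) ^+ 2 =
    \sum_i (S i ^+ 2 + 2 * (S i * (z q i - g i)) + (z q i - g i) ^+ 2).
  apply: eq_bigr => i _; rewrite big_ord_recl unlift_none /=.
  under eq_bigr do rewrite liftK /=.
  by rewrite -/(S i) addrC sqrrD mulr_natl.
rewrite !big_split /= -mulr_sumr mulSn natrD.
have : \sum_i (z q i - g i) ^+ 2 <= #|I|%:R.
  rewrite -sumr_const; apply: ler_sum => i _.
  by rewrite -real_normK ?num_real // expr_le1.
move: IH; rewrite -/S => IH; lra.
Qed.

Lemma grid_approx (L : nat) (x : R) : 0 <= x <= 1 ->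
  exists k : 'I_L.+2, `|x - k%:R / L.+1%:R| <= L.+1%:R^-1.
Proof.
move=> /andP[x0 x1]; have L0 : 0 < L.+1%:R :> R by rewrite ltr0n.
have y0 : 0 <= x * L.+1%:R by rewrite mulr_ge0 // ltW.
(* [x = 1] gives the index [L.+1], so the grid needs [L.+2] points. *)
have kL : (Num.truncn (x * L.+1%:R) < L.+2)%N.
  rewrite truncn_lt_nat // (le_lt_trans _ (_ : L.+1%:R < _)) ?ltr_nat //.
  by rewrite ler_piMl // ltW.
exists (Ordinal kL) => /=; have /andP[] := truncn_itv y0.
set k := Num.truncn _ => k1 k2.
rewrite -[x in `|x - _|](mulfK (lt0r_neq0 L0)) -mulrBl normrM.
rewrite [`|_^-1|]gtr0_norm ?invr_gt0 // ler_piMl ?invr_ge0 ?(ltW L0) //.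
by rewrite ger0_norm ?subr_ge0 // lerBlDl natr1 ltW.
Qed.

(** The label of [i] records the rounded values of [u] and [v] at [i] for [s] well-chosen samples.
    Both [s] and the grid depend on [eta] alone, so [T] is chosen before [N] and [Q]. The inhabitant
    of [T] later serves as a default label. *)
Lemma step_approx (eta : R) : 0 < eta -> exists (T : finType) (_ : T),
  forall (N : nat) (Q : finType) (u v : Q -> 'I_N -> R), (0 < #|Q|)%N ->
  (forall q i, 0 <= u q i <= 1) -> (forall q i, 0 <= v q i <= 1) ->
  exists (P : T -> T -> R) (c : 'I_N -> T),
  \sum_i \sum_j `|(\sum_q u q i * v q j) / #|Q|%:R - P (c i) (c j)|
    <= eta * (N * N)%:R.
Proof.
(* Error budget: [s > e ^- 2] samples cost at most [e] per entry on average, and rounding both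
   factors to mesh [1 / L.+1] costs at most [2 / L.+1 <= e]. *)
move=> eta0; pose e := eta / 2; have e0 : 0 < e by rewrite divr_gt0.
pose s := (Num.truncn (e ^- 2)).+1; pose L := Num.truncn (4 / eta).
have s0 : 0 < s%:R :> R by rewrite ltr0n.
have Hs : e ^- 2 < s%:R by exact: truncnS_gt.
have L0 : 0 < L.+1%:R :> R by rewrite ltr0n.
have HL : 2 * L.+1%:R^-1 <= e.
  have : 4 / eta < L.+1%:R by exact: truncnS_gt.
  by rewrite ltr_pdivrMr // ler_pdivrMr // /e => H; lra.
exists {ffun 'I_s -> 'I_L.+2 * 'I_L.+2}, [ffun=> (ord0, ord0)] => N Q u v Q0 u01 v01.
have Qr : 0 < #|Q|%:R :> R by rewrite ltr0n.
pose z q (p : 'I_N * 'I_N) := u q p.1 * v q p.2.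
pose g p := (\sum_q z q p) / #|Q|%:R.
have z01 q p : 0 <= z q p <= 1.
  have /andP[? ?] := u01 q p.1; have /andP[? ?] := v01 q p.2.
  by rewrite mulr_ge0 // mulr_ile1.
have g01 p : 0 <= g p <= 1.
  rewrite /g divr_ge0 ?(ltW Qr) ?sumr_ge0 //=; last first.
    by move=> q _; case/andP: (z01 q p).
  rewrite ler_pdivrMr // mul1r -sumr_const ler_sum // => q _.
  by case/andP: (z01 q p).
have zg q p : `|z q p - g p| <= 1.
  have /andP[? ?] := z01 q p; have /andP[? ?] := g01 p.
  by rewrite ler_norml; apply/andP; split; lra.
have [qs Hqs] := exists_sample Q0 (fun p => erefl (g p)) zg s.
have grid (w : Q -> 'I_N -> R) : (forall q i, 0 <= w q i <= 1) ->
    {k : 'I_N -> 'I_s -> 'I_L.+2 |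
     forall i t, `|w (qs t) i - (k i t)%:R / L.+1%:R| <= L.+1%:R^-1}.
  move=> w01.
  pose Pr i (k : 'I_s -> 'I_L.+2) := forall t,
    `|w (qs t) i - (k t)%:R / L.+1%:R| <= L.+1%:R^-1.
  have ex i : exists k, Pr i k.
    have H t : exists k : 'I_L.+2, `|w (qs t) i - k%:R / L.+1%:R| <= L.+1%:R^-1.
      by apply: grid_approx; apply: w01.
    by have [k Hk] := choice H; exists k.
  by have [k Hk] := choice ex; exists k.
have [ku Hku] := grid u u01; have [kv Hkv] := grid v v01.
pose T : finType := {ffun 'I_s -> 'I_L.+2 * 'I_L.+2}.
pose P (x y : T) : R :=
  (\sum_t ((x t).1%:R / L.+1%:R) * ((y t).2%:R / L.+1%:R)) / s%:R.
pose c i : T := [ffun t => (ku i t, kv i t)].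
exists P, c.
pose D p := \sum_t (z (qs t) p - g p).
(* The first two terms bound the sampling error [|D| / s] by the AM-GM inequality, which makes the
   L2 bound on [D] usable in L1 norm; the last [e] is the rounding error. *)
have pt i j : `|(\sum_q u q i * v q j) / #|Q|%:R - P (c i) (c j)|
   <= e / 2 + (2 * e * s%:R ^+ 2)^-1 * D (i, j) ^+ 2 + e.
  rewrite /P; set A := \sum_(t < s) _.
  have PD : `|A - \sum_t z (qs t) (i, j)| <= s%:R * e.
    rewrite /A -sumrB (le_trans (ler_norm_sum _ _ _)) //.
    have -> : s%:R * e = \sum_(t < s) e by rewrite sumr_const card_ord mulr_natl.
    apply: ler_sum => t _; rewrite !ffunE /=.
    have := Hku i t; have := Hkv j t; rewrite /z /=.
    set a := u _ _; set b := v _ _; set b' := _ / _; set a' := _ / _ => Hb Ha.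
    have a01 : `|a| <= 1 by case/andP: (u01 (qs t) i) => ? ?; rewrite ger0_norm.
    have b'01 : `|b'| <= 1.
      rewrite ger0_norm ?divr_ge0 // ler_pdivrMr // mul1r ler_nat.
      by have := ltn_ord (kv j t); rewrite ltnS.
    rewrite (_ : a' * b' - a * b = (a' - a) * b' + a * (b' - b)); last by ring.
    apply: le_trans (ler_normD _ _) _; rewrite 2!(normrM (_ - _), normrM a); apply: le_trans HL.
    rewrite distrC in Ha; rewrite distrC in Hb; clearbody b'.
    rewrite mulr_natl mulr2n lerD //.
      by rewrite (le_trans _ Ha) // ler_piMr.
    by rewrite (le_trans _ Hb) // ler_piMl.
  have DE : (\sum_q u q i * v q j) / #|Q|%:R =
      (\sum_t z (qs t) (i, j) - D (i, j)) / s%:R.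
    rewrite /D sumrB sumr_const card_ord subKr -[X in _ = X / _]mulr_natr mulfK ?gt_eqF //.
  rewrite DE -mulrBl.
  rewrite (_ : _ - D (i, j) - A = - (D (i, j)) - (A - \sum_t z (qs t) (i, j)));
    last by ring.
  rewrite mulrBl (le_trans (ler_normB _ _)) // lerD //; last first.
    by rewrite normrM (gtr0_norm (_ : 0 < s%:R^-1)) ?invr_gt0 // ler_pdivrMr // mulrC.
  rewrite mulNr normrN normrM (gtr0_norm (_ : 0 < s%:R^-1)) ?invr_gt0 //.
  set d := D _; rewrite -subr_ge0 -[d ^+ 2]real_normK ?num_real //.
  (* The gap in the AM-GM inequality is a perfect square. *)
  rewrite (_ : _ - _ = (2 * e)^-1 * (e - `|d| / s%:R) ^+ 2).
    by rewrite mulr_ge0 ?sqr_ge0 // invr_ge0 mulr_ge0 // ltW.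
  by field; rewrite !gt_eqF.
apply: le_trans (ler_sum _ (fun i _ => ler_sum _ (fun j _ => pt i j))) _.
rewrite pair_bigA /=.
under eq_bigr do rewrite -surjective_pairing.
rewrite !big_split /= !sumr_const -mulr_sumr card_prod card_ord.
rewrite card_prod card_ord in Hqs.
have K0 : 0 <= (2 * e * s%:R ^+ 2)^-1.
  by rewrite invr_ge0 mulr_ge0 ?sqr_ge0 // mulr_ge0 // ltW.
have H := ler_wpM2l K0 Hqs.
have M0 : 0 <= (N * N)%:R :> R by [].
(* The squared norm of [D] is at most [s * N * N], which leaves [1 / (2 e s)] per entry; this is at
   most [e / 2] since [s > e ^- 2]. *)
have {}H : (2 * e * s%:R ^+ 2)^-1 * (\sum_p D p ^+ 2) <= e / 2 * (N * N)%:R.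
  apply: le_trans H _; rewrite natrM mulrA ler_wpM2r //.
  rewrite (_ : _ * s%:R = e / 2 * (e ^- 2 / s%:R)).
    rewrite ler_piMr //; first by rewrite divr_ge0 // ltW.
    by rewrite ler_pdivrMr // mul1r ltW.
  by field; rewrite !gt_eqF.
rewrite -(mulr_natr (e / 2)) -(mulr_natr e).
have -> : eta = e + e by rewrite /e; lra.
lra.
Qed.

(** * Subgraph densities as sums over all maps, and their discrete derivatives *)

(* The factors [(s != t)%:R] turn the sum over injective maps into a sum over
   all maps. *)
Definition pair_weight (m N : nat) (adj : rel 'I_m) (X : 'M[R]_N)
    (p : 'I_m * 'I_m) (s t : 'I_N) : R :=
  (s != t)%:R * (if adj p.1 p.2 then X s t else 1).

Lemma pair_weight_itv (m N : nat) (adj : rel 'I_m) (X : 'M[R]_N) p s t :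
  (forall i j, 0 <= X i j <= 1) -> 0 <= pair_weight adj X p s t <= 1.
Proof.
move=> X01; rewrite /pair_weight; case: (s != t); last by rewrite mul0r lexx ler01.
by rewrite mul1r; case: ifP => // _; rewrite ler01 lexx.
Qed.

Lemma injectivePn_lt (m : nat) (T : eqType) (q : 'I_m -> T) :
  ~~ injectiveb q -> exists p : 'I_m * 'I_m, (p.1 < p.2)%N /\ q p.1 = q p.2.
Proof.
move=> /injectivePn[x [y xy qxy]]; move: xy; rewrite neq_ltn => /orP[xy|yx].
  by exists (x, y).
by exists (y, x).
Qed.

Lemma prod_pair_weight0 (m N : nat) (adj : rel 'I_m) (X : 'M[R]_N)
    (q : {ffun 'I_m -> 'I_N}) (A : pred ('I_m * 'I_m)) p :
  A p -> q p.1 = q p.2 ->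
  \prod_(p' | A p') pair_weight adj X p' (q p'.1) (q p'.2) = 0.
Proof.
by move=> Ap qp; rewrite (bigD1 p) //= /pair_weight qp eqxx !mul0r.
Qed.

Lemma sum_injective_prod (m N : nat) (adj : rel 'I_m) (X : 'M[R]_N) :
  \sum_(q : {ffun 'I_m -> 'I_N} | injectiveb q)
     \prod_(l : 'I_m) \prod_(l' : 'I_m | (l < l')%N && adj l l')
        X (q l) (q l') =
  \sum_(q : {ffun 'I_m -> 'I_N}) \prod_(p : 'I_m * 'I_m | (p.1 < p.2)%N)
     pair_weight adj X p (q p.1) (q p.2).
Proof.
rewrite big_mkcond; apply: eq_bigr => q _.
case: ifPn => [/injectiveP q_inj|/injectivePn_lt[p [plt qp]]]; last first.
  by rewrite (prod_pair_weight0 _ _ plt qp).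
rewrite pair_big_dep /= big_mkcondr /=; apply: eq_bigr => p plt.
rewrite /pair_weight (_ : q p.1 != q p.2) ?mul1r //.
by apply: contraTneq plt => /q_inj ->; rewrite ltnn.
Qed.

(** An injective [q] sends at most one ordered pair onto the positions [i], [j], so the product is
    affine in that matrix entry, and the difference is the product with the factor of that edge
    removed. For non-injective [q] both sides vanish. *)
Lemma prod_upd_diff (m N : nat) (adj : rel 'I_m) (X : 'M[R]_N) (i j : 'I_N)
    (q : {ffun 'I_m -> 'I_N}) : i != j ->
  \prod_(p : 'I_m * 'I_m | (p.1 < p.2)%N)
     pair_weight adj (upd X i j 1) p (q p.1) (q p.2) -
  \prod_(p : 'I_m * 'I_m | (p.1 < p.2)%N)
     pair_weight adj (upd X i j 0) p (q p.1) (q p.2) =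
  \sum_(e : 'I_m * 'I_m | (e.1 < e.2)%N && adj e.1 e.2)
     (((q e.1 == i) && (q e.2 == j))%:R + ((q e.1 == j) && (q e.2 == i))%:R) *
     \prod_(p : 'I_m * 'I_m | (p.1 < p.2)%N && (p != e)) pair_weight adj X p (q p.1) (q p.2).
Proof.
move=> ij; pose hit (p : 'I_m * 'I_m) :=
  ((q p.1 == i) && (q p.2 == j)) || ((q p.1 == j) && (q p.2 == i)).
have hitN e : ~~ hit e ->
    ((q e.1 == i) && (q e.2 == j))%:R + ((q e.1 == j) && (q e.2 == i))%:R = 0 :> R.
  by rewrite negb_or => /andP[/negbTE -> /negbTE ->]; rewrite addr0.
have hit1 e : hit e ->
    ((q e.1 == i) && (q e.2 == j))%:R + ((q e.1 == j) && (q e.2 == i))%:R = 1 :> R.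
  case/orP => /andP[/eqP -> /eqP ->]; rewrite !eqxx (negbTE ij) ?addr0 //=.
  by rewrite eq_sym (negbTE ij) add0r.
have [q_inj|/injectivePn_lt[p0 [plt qp]]] := boolP (injectiveb q); last first.
  rewrite !(prod_pair_weight0 _ _ plt qp) subrr big1 // => e _.
  have [he|/hitN ->] := boolP (hit e); last by rewrite mul0r.
  (* The colliding pair [p0] survives the removal of [e]: the endpoints of [e] have the distinct
     images [i] and [j]. *)
  rewrite (@prod_pair_weight0 _ _ _ _ _ _ p0) ?mulr0 //= plt /=.
  apply: contraTneq he => <-; rewrite /hit qp negb_or.
  by apply/andP; split; apply: contra ij => /andP[/eqP<- /eqP<-].
have {}q_inj := injectiveP _ q_inj.
have updN a p : ~~ hit p ->
    pair_weight adj (upd X i j a) p (q p.1) (q p.2) =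
    pair_weight adj X p (q p.1) (q p.2).
  by rewrite /pair_weight /upd mxE /hit => /negbTE ->.
have hit_uniq (e p : 'I_m * 'I_m) : (e.1 < e.2)%N -> (p.1 < p.2)%N -> hit e -> p != e -> ~~ hit p.
  move=> elt plt he; apply: contra => hp; apply/eqP; rewrite [p]surjective_pairing.
  case: e elt he => a b /= ab he.
  move: he hp; rewrite /hit /= => /orP[] /andP[/eqP ha /eqP hb] /orP[] /andP[];
    rewrite -ha -hb => /eqP/q_inj h1 /eqP/q_inj h2; rewrite ?h1 ?h2 //;
    by move: plt; rewrite h1 h2 ltnNge (ltnW ab).
pose A := [pred e : 'I_m * 'I_m | (e.1 < e.2)%N && adj e.1 e.2].
have [e /andP[/andP[elt eadj] he]|nohit] := pickP (predI A hit); last first.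
  rewrite [RHS]big1; last first.
    move=> e Ae; have := nohit e; rewrite /= Ae /= => /negbT/hitN ->.
    by rewrite mul0r.
  apply/eqP; rewrite subr_eq0; apply/eqP/eq_bigr => p plt.
  (* A pair sent onto [i], [j] is here a non-edge, so its weight does not read the matrix. *)
  have [hp|hp] := boolP (hit p); last by rewrite !updN.
  by have := nohit p; rewrite /= plt hp andbT /= /pair_weight => ->.
rewrite !(bigD1 e elt) /= [RHS](bigD1 e) /= ?elt // hit1 // mul1r.
rewrite [X in _ = _ + X]big1 ?addr0; last first.
  move=> p /andP[/andP[plt _] pe].
  by rewrite hitN ?mul0r //; apply: hit_uniq pe.
have prodN a : \prod_(p : 'I_m * 'I_m | (p.1 < p.2)%N && (p != e))
      pair_weight adj (upd X i j a) p (q p.1) (q p.2) =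
    \prod_(p : 'I_m * 'I_m | (p.1 < p.2)%N && (p != e)) pair_weight adj X p (q p.1) (q p.2).
  by apply: eq_bigr => p /andP[plt pe]; apply: updN; apply: hit_uniq pe.
rewrite !prodN.
have weight_e a : pair_weight adj (upd X i j a) e (q e.1) (q e.2) = a.
  rewrite /pair_weight eadj /upd mxE; move: he; rewrite /hit => he.
  rewrite he (_ : q e.1 != q e.2) ?mul1r //.
  by apply: contraTneq elt => /q_inj ->; rewrite ltnn.
by rewrite !weight_e mul0r mul1r subr0.
Qed.

(** For an edge [e] and [i != j], this counts the injective copies of the graph without [e], rooted
    at [(i, j)] and weighted by [X]. It need not be symmetric in [i] and [j], so both orientations
    occur below. *)
Definition edge_sum (m N : nat) (adj : rel 'I_m) (X : 'M[R]_N)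
    (e : 'I_m * 'I_m) (i j : 'I_N) : R :=
  \sum_(q : {ffun 'I_m -> 'I_N} | (q e.1 == i) && (q e.2 == j))
     \prod_(p : 'I_m * 'I_m | (p.1 < p.2)%N && (p != e)) pair_weight adj X p (q p.1) (q p.2).

Lemma tdens_upd_diff (N : nat) (H : sgraph) (X : 'M[R]_N) (i j : 'I_N) : i != j ->
  tdens H (upd X i j 1) - tdens H (upd X i j 0) =
  (\sum_(e : 'I_(gm H) * 'I_(gm H) | (e.1 < e.2)%N && gadj H e.1 e.2)
     (edge_sum (gadj H) X e i j + edge_sum (gadj H) X e j i)) / (N ^_ (gm H))%:R.
Proof.
move=> ij; rewrite /tdens -mulrBl !sum_injective_prod -sumrB.
under eq_bigr do rewrite prod_upd_diff //.
rewrite exchange_big /=; congr (_ / _); apply: eq_bigr => e _.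
rewrite /edge_sum [X in _ = X + _]big_mkcond [X in _ = _ + X]big_mkcond -big_split /=.
apply: eq_bigr => q _; rewrite mulrDl; congr (_ + _);
  by case: ifP; rewrite ?mul1r ?mul0r.
Qed.

(** * Edge sums as averages of rank-one matrices *)

Definition set_endpoints (m N : nat) (e : 'I_m * 'I_m) (i j : 'I_N)
    (r : {ffun 'I_m -> 'I_N}) : {ffun 'I_m -> 'I_N} :=
  [ffun x => if x == e.1 then i else if x == e.2 then j else r x].

(** Each admissible [q] arises from [N * N] maps [r], one for each choice of the two overwritten
    values. The sum over [r] has an index set independent of [(i, j)], as the sampling argument
    requires. *)
Lemma sum_set_endpoints (m N : nat) (e : 'I_m * 'I_m) (i j : 'I_N)
    (G : {ffun 'I_m -> 'I_N} -> R) : e.1 != e.2 ->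
  \sum_r G (set_endpoints e i j r) =
  (N * N)%:R * \sum_(q : {ffun 'I_m -> 'I_N} | (q e.1 == i) && (q e.2 == j)) G q.
Proof.
move=> e12; have e21 : e.2 == e.1 = false by rewrite eq_sym (negbTE e12).
rewrite (partition_big (fun r : {ffun _} => (r e.1, r e.2)) predT) //=.
have fiber (y : 'I_N * 'I_N) :
    \sum_(r : {ffun 'I_m -> 'I_N} | (r e.1, r e.2) == y) G (set_endpoints e i j r) =
    \sum_(q : {ffun 'I_m -> 'I_N} | (q e.1 == i) && (q e.2 == j)) G q.
  (* Fixing the forgotten values [y] makes overwriting a bijection, inverted by writing [y] back. *)
  rewrite [RHS](reindex_onto (set_endpoints e i j) (set_endpoints e y.1 y.2)); last first.
    move=> q /andP[/eqP qi /eqP qj]; apply/ffunP => x; rewrite !ffunE.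
    by case: eqP => [->//|_]; case: eqP => [->//|_].
  apply: eq_bigl => r; rewrite !ffunE !eqxx e21 !eqxx /=.
  apply/eqP/eqP => [<-|<-] /=.
    apply/ffunP => x; rewrite !ffunE.
    by case: eqP => [->//|_]; case: eqP => [->//|_].
  by rewrite !ffunE !eqxx e21 -surjective_pairing.
under eq_bigr do rewrite fiber.
by rewrite sumr_const card_prod card_ord mulr_natl.
Qed.

(* No pair [p != e] contains both endpoints of [e]: this is what makes the
   product a rank-one function of [(i, j)]. *)
Lemma prod_set_endpoints_factor (m N : nat) (e : 'I_m * 'I_m)
    (F : 'I_m * 'I_m -> 'I_N -> 'I_N -> R) :
  (e.1 < e.2)%N -> (forall p s t, 0 <= F p s t <= 1) ->
  exists u v : {ffun 'I_m -> 'I_N} -> 'I_N -> R,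
  [/\ forall r i, 0 <= u r i <= 1, forall r j, 0 <= v r j <= 1 &
      forall r i j,
        \prod_(p : 'I_m * 'I_m | (p.1 < p.2)%N && (p != e))
          F p (set_endpoints e i j r p.1) (set_endpoints e i j r p.2) = u r i * v r j].
Proof.
move=> elt F01; pose B := [pred p : 'I_m * 'I_m | (p.1 == e.2) || (p.2 == e.2)].
have prod01 (A : pred ('I_m * 'I_m)) (r : {ffun 'I_m -> 'I_N}) :
    0 <= \prod_(p | A p) F p (r p.1) (r p.2) <= 1.
  by rewrite prodr_ge0 ?prodr_ile1 // => p _; case/andP: (F01 p (r p.1) (r p.2)).
(* Pairs through [e.2] go to [v], all others to [u]. Writing the same vertex at both endpoints is
   harmless: the pairs in [u] avoid [e.2], and those in [v] avoid [e.1] because [p != e]. *)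
exists (fun r i => \prod_(p : 'I_m * 'I_m | ((p.1 < p.2)%N && (p != e)) && ~~ B p)
          F p (set_endpoints e i i r p.1) (set_endpoints e i i r p.2)).
exists (fun r j => \prod_(p : 'I_m * 'I_m | ((p.1 < p.2)%N && (p != e)) && B p)
          F p (set_endpoints e j j r p.1) (set_endpoints e j j r p.2)).
split=> [r i|r j|r i j]; [exact: prod01|exact: prod01|].
rewrite (bigID B) [LHS]mulrC /=; congr (_ * _); apply: eq_bigr => p.
  move=> /andP[_ /norP[/negbTE b1 /negbTE b2]].
  by rewrite !ffunE b1 b2.
move=> /andP[/andP[plt pe] /orP[] /eqP pb]; rewrite !ffunE.
  have p1 : p.1 == e.1 = false by rewrite pb -val_eqE gtn_eqF.
  have p2 : p.2 == e.1 = false.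
    by apply/negbTE; rewrite neq_ltn (ltn_trans elt) ?orbT // -pb.
  by rewrite p1 p2.
have p2 : p.2 == e.1 = false by rewrite pb -val_eqE gtn_eqF.
have p1 : p.1 == e.1 = false.
  by apply: contraNF pe => /eqP p1; rewrite [p]surjective_pairing p1 pb -surjective_pairing.
by rewrite p1 p2.
Qed.

(** Scaling by [N * N / N ^ m] turns the edge sum into the mean over all maps [r] of rank-one terms.
    The label type is uniform in the graph, the edge and [X]. *)
Lemma edge_sum_step (eta : R) : 0 < eta -> exists (T : finType) (_ : T),
  forall (m N : nat) (adj : rel 'I_m) (X : 'M[R]_N) (e : 'I_m * 'I_m),
  (0 < N)%N -> (e.1 < e.2)%N -> (forall i j, 0 <= X i j <= 1) ->
  exists (P : T -> T -> R) (c : 'I_N -> T),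
  \sum_i \sum_j `|(N * N)%:R * edge_sum adj X e i j / (N ^ m)%:R - P (c i) (c j)|
    <= eta * (N * N)%:R.
Proof.
move=> /step_approx[T [t0 HT]]; exists T, t0 => m N adj X e N0 elt X01.
have [u [v [u01 v01 uv]]] :=
  prod_set_endpoints_factor elt (fun p s t => pair_weight_itv adj p s t X01).
have Q0 : (0 < #|{ffun 'I_m -> 'I_N}|)%N by rewrite card_ffun !card_ord expn_gt0 N0.
have [P [c Pc]] := HT N _ u v Q0 u01 v01; exists P, c.
apply: le_trans Pc; rewrite le_eqVlt; apply/orP; left; apply/eqP.
apply: eq_bigr => i _; apply: eq_bigr => j _; congr `|_ / _%:R - _|.
  rewrite /edge_sum -(sum_set_endpoints i j (fun q => \prod_(p : 'I_m * 'I_m | (p.1 < p.2)%N && (p != e))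
    pair_weight adj X p (q p.1) (q p.2))) ?neq_ltn ?elt //.
  by apply: eq_bigr => r _; rewrite uv.
by rewrite card_ffun !card_ord.
Qed.

(** * The gradient as a bounded combination of edge sums, and its step approximation *)

Lemma expn_le_ffact (m N : nat) : (m <= N)%N -> (N ^ m <= m ^ m * N ^_ m)%N.
Proof.
have prodc n k : (n ^ k = \prod_(i < k) n)%N by rewrite prod_nat_const card_ord.
move=> mN; rewrite ffact_prod 2!prodc -big_split /=.
(* Factorwise, [N <= m * (N - i)] for [i < m <= N]. *)
by apply: leq_prod => i _; have := ltn_ord i; nia.
Qed.

Lemma sum_ltn_swap_le (N : nat) (D : 'I_N -> 'I_N -> R) :
  (forall i j, 0 <= D i j) ->
  \sum_(i < N) \sum_(j < N | (i < j)%N) (D i j + D j i)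
    <= 2 * \sum_i \sum_j D i j.
Proof.
move=> D0; have sub (E : 'I_N -> 'I_N -> R) : (forall i j, 0 <= E i j) ->
    \sum_(i < N) \sum_(j < N | (i < j)%N) E i j <= \sum_i \sum_j E i j.
  move=> E0; apply: ler_sum => i _; rewrite big_mkcond; apply: ler_sum => j _.
  by case: ifP.
under eq_bigr do rewrite big_split /=.
rewrite big_split /= mulr_natl mulr2n lerD ?sub //.
by rewrite [leRHS]exchange_big /= (sub (fun i j => D j i)).
Qed.

(** Collects the 1/2 of the discrete derivative, the prefactor [N * N.-1] and the change from
    injective to all maps, grouped into quotients that stay bounded as [N] grows. *)
Definition edge_coeff (l : nat) (Hs : 'I_l -> sgraph) (beta : 'I_l -> R)
    (N : nat) (k : 'I_l) : R :=
  beta k / 2 * ((N * N.-1)%:R / (N * N)%:R *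
    ((N ^ gm (Hs k))%:R / (N ^_ gm (Hs k))%:R)).

Lemma norm_edge_coeff (l : nat) (Hs : 'I_l -> sgraph) (beta : 'I_l -> R)
    (N : nat) (k : 'I_l) : (0 < N)%N ->
  `|edge_coeff Hs beta N k| <= `|beta k| / 2 * (gm (Hs k) ^ gm (Hs k))%:R.
Proof.
move=> N0; rewrite /edge_coeff normrM normrM [`|2^-1|]ger0_norm ?invr_ge0 //.
rewrite ler_wpM2l ?divr_ge0 // ger0_norm ?mulr_ge0 ?invr_ge0 //.
have r1 : (N * N.-1)%:R / (N * N)%:R <= 1 :> R.
  by rewrite ler_pdivrMr ?mul1r ?ltr0n ?muln_gt0 ?N0 // ler_nat leq_mul2l leq_pred orbT.
apply: le_trans (ler_piMl _ r1) _; first by rewrite mulr_ge0 ?invr_ge0.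
(* If the graph has more than [N] vertices, the falling factorial is 0 and so is its inverse. *)
have [mN|Nm] := leqP (gm (Hs k)) N; last first.
  by rewrite (ffact_small Nm) invr0 mulr0.
by rewrite ler_pdivrMr ?ltr0n ?ffact_gt0 // -natrM ler_nat expn_le_ffact.
Qed.

Lemma dpart_fcount (l : nat) (Hs : 'I_l -> sgraph) (beta : 'I_l -> R)
    (N : nat) (X : 'M[R]_N) (i j : 'I_N) : i != j ->
  dpart (@fcount R l Hs beta N) X i j =
  \sum_(x : {k : 'I_l & ('I_(gm (Hs k)) * 'I_(gm (Hs k)))%type} |
        ((tagged x).1 < (tagged x).2)%N &&
          gadj (Hs (tag x)) (tagged x).1 (tagged x).2)
    edge_coeff Hs beta N (tag x) *
    ((N * N)%:R * edge_sum (gadj (Hs (tag x))) X (tagged x) i j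
        / (N ^ gm (Hs (tag x)))%:R +
     (N * N)%:R * edge_sum (gadj (Hs (tag x))) X (tagged x) j i
        / (N ^ gm (Hs (tag x)))%:R).
Proof.
move=> ij; rewrite /dpart /fcount -mulrBr -sumrB.
have N0 : (0 < N)%N by case: (N) i {ij} => [[]|].
pose E k (e : 'I_(gm (Hs k)) * 'I_(gm (Hs k))) :=
  (e.1 < e.2)%N && gadj (Hs k) e.1 e.2.
pose F k (e : 'I_(gm (Hs k)) * 'I_(gm (Hs k))) :=
  edge_coeff Hs beta N k *
    ((N * N)%:R * edge_sum (gadj (Hs k)) X e i j / (N ^ gm (Hs k))%:R +
     (N * N)%:R * edge_sum (gadj (Hs k)) X e j i / (N ^ gm (Hs k))%:R).
rewrite -(sig_big_dep predT E F) /= mulr_sumr mulr_suml.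
apply: eq_bigr => k _; rewrite -mulrBr (tdens_upd_diff _ _ ij).
rewrite mulr_suml !(mulr_sumr, mulr_suml); apply: eq_bigr => e _.
rewrite /F /edge_coeff.
have [->|f0] := eqVneq (N ^_ gm (Hs k))%:R (0 : R).
  by rewrite invr0 !(mulr0, mul0r).
by field; rewrite f0 !pnatr_eq0 -!lt0n expn_gt0 N0.
Qed.

(** A vertex carries one label per pair (graph, edge). The number of such pairs does not depend on
    [N], so the product type is still a fixed finite type. Adding both orientations makes [P]
    symmetric. *)
Lemma dpart_step (l : nat) (Hs : 'I_l -> sgraph) (beta : 'I_l -> R) (eta : R) :
  0 < eta -> exists T : finType,
  forall (N : nat) (X : 'M[R]_N), (0 < N)%N -> (forall i j, 0 <= X i j <= 1) ->
  exists (P : T -> T -> R) (c : 'I_N -> T),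
  (forall a b, P a b = P b a) /\
  \sum_(i < N) \sum_(j < N | (i < j)%N)
    `|dpart (@fcount R l Hs beta N) X i j - P (c i) (c j)| <= eta * (N * N)%:R.
Proof.
move=> eta0.
pose I : finType := {k : 'I_l & ('I_(gm (Hs k)) * 'I_(gm (Hs k)))%type}.
pose E := [pred x : I | ((tagged x).1 < (tagged x).2)%N &&
          gadj (Hs (tag x)) (tagged x).1 (tagged x).2].
pose B (x : I) : R := `|beta (tag x)| * (gm (Hs (tag x)) ^ gm (Hs (tag x)))%:R.
pose M := \sum_x B x.
have M0 : 0 <= M by apply: sumr_ge0 => x _; rewrite mulr_ge0.
have M1 : 0 < M + 1 by rewrite ltr_wpDl.
(* The coefficients sum to at most [M], so accuracy [eta / (M + 1)] per edge suffices; the [+ 1]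
   keeps the divisor positive. *)
have [T [t0 HT]] := edge_sum_step (divr_gt0 eta0 M1).
exists {ffun I -> T} => N X N0 X01.
pose A (x : I) i j : R := (N * N)%:R * edge_sum (gadj (Hs (tag x))) X (tagged x) i j
        / (N ^ gm (Hs (tag x)))%:R.
have ex (x : I) : exists Pc : (T -> T -> R) * ('I_N -> T), E x ->
    \sum_i \sum_j `|A x i j - Pc.1 (Pc.2 i) (Pc.2 j)| <= eta / (M + 1) * (N * N)%:R.
  have [/andP[xlt _]|] := boolP (E x); last by exists (fun _ _ => 0, fun=> t0).
  have [P [c Pc]] := HT _ N (gadj (Hs (tag x))) X (tagged x) N0 xlt X01.
  by exists (P, c).
have [Pc HPc] := choice ex; pose lam (x : I) := edge_coeff Hs beta N (tag x).
pose Px x a b := (Pc x).1 a b; pose cx x i := (Pc x).2 i.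
pose P (a b : {ffun I -> T}) : R :=
  \sum_(x | E x) lam x * (Px x (a x) (b x) + Px x (b x) (a x)).
pose c i : {ffun I -> T} := [ffun x => cx x i].
exists P, c; split; first by move=> a b; apply: eq_bigr => x _; rewrite addrC.
pose D x i j := `|A x i j - Px x (cx x i) (cx x j)|.
have pt (i j : 'I_N) : (i < j)%N ->
  `|dpart (@fcount R l Hs beta N) X i j - P (c i) (c j)|
  <= \sum_(x | E x) `|lam x| * (D x i j + D x j i).
  move=> ij; rewrite dpart_fcount ?neq_ltn ?ij // -sumrB.
  apply: le_trans (ler_norm_sum _ _ _) _; apply: ler_sum => x _.
  rewrite -mulrBr normrM ler_wpM2l // !ffunE /D opprD addrACA.
  exact: ler_normD.
apply: le_trans (ler_sum _ (fun i _ => ler_sum _ (pt i))) _.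
under eq_bigr do rewrite exchange_big /=.
rewrite exchange_big /=.
have bound x : E x -> \sum_(i < N) \sum_(j < N | (i < j)%N)
     `|lam x| * (D x i j + D x j i) <= B x * (eta / (M + 1) * (N * N)%:R).
  move=> Ex; under eq_bigr do rewrite -mulr_sumr.
  rewrite -mulr_sumr.
  have D2 : \sum_(i < N) \sum_(j < N | (i < j)%N) (D x i j + D x j i) <=
      2 * (eta / (M + 1) * (N * N)%:R).
    apply: le_trans (sum_ltn_swap_le _) _; first by move=> i j; exact: normr_ge0.
    by rewrite ler_wpM2l // HPc.
  apply: le_trans (ler_wpM2l (normr_ge0 _) D2) _.
  have e0 : 0 <= 2 * (eta / (M + 1) * (N * N)%:R).
    by rewrite mulr_ge0 // mulr_ge0 // divr_ge0 // ltW.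
  apply: le_trans (ler_wpM2r e0 (norm_edge_coeff Hs beta (tag x) N0)) _.
  (* The 2 from the two orientations cancels the 1/2 in [edge_coeff]. *)
  by rewrite /B le_eqVlt; apply/orP; left; apply/eqP; field; rewrite gt_eqF.
apply: le_trans (ler_sum _ bound) _; rewrite -mulr_suml mulrA.
rewrite ler_wpM2r // mulrCA ler_piMr ?(ltW eta0) // ler_pdivrMr // mul1r.
apply: (@le_trans _ _ M); last by rewrite lerDl.
rewrite /M big_mkcond /=; apply: ler_sum => x _; case: ifP => // _.
by rewrite mulr_ge0.
Qed.

End BlockApproximation.

(** * From the gradient to the block matrix *)

Theorem theorem14 (R : realType) (delta : R) (l : nat)
    (Hs : 'I_l -> sgraph) (beta : 'I_l -> R) :
  0 < delta < 1 ->
  exists C : R, 0 < C /\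
    forall (N : nat) (X : 'M[R]_N), (2 <= N)%N ->
      in_Xf Hs beta X ->
      exists (k : nat) (Xs : 'M[R]_N),
        k%:R <= C /\ block_matrix k Xs /\
        l1pairs (X - Xs) <= delta * nN R N
                            + 5000 * Cbeta Hs beta ^+ 2 * powR (nN R N) (15%:R / 16%:R).
Proof.
(* The 8 is 2 times 4: halving the Lipschitz constant 4 leaves 2, and [N * N] is at most 4 times
   [nN R N]. *)
case/andP => d0 _; have d8 : 0 < delta / 8 by rewrite divr_gt0.
have [T HT] := dpart_step Hs beta d8.
exists (#|T|%:R + 1); split; first by rewrite ltr_wpDl.
move=> N X N2 [[_ [_ X01]] HX].
have [P [c [Psym HP]]] := HT N X (ltnW N2) X01.
exists #|T|, (\matrix_(i, j) ((1 + tanhR (P (c i) (c j))) / 2)).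
split; first by rewrite lerDl.
split.
  (* The communities are the label classes, numbered by the enumeration of [T]. *)
  exists (\matrix_(a, b) ((1 + tanhR (P (enum_val a) (enum_val b))) / 2)).
  exists (fun i => enum_rank (c i)); split=> i j; rewrite !mxE.
    by rewrite Psym.
  by rewrite !enum_rankK.
set f := @fcount R l Hs beta N in HX HP *.
have pt (i j : 'I_N) : (i < j)%N ->
    `|(X - \matrix_(i, j) ((1 + tanhR (P (c i) (c j))) / 2)) i j| <=
    `|X i j - (1 + tanhR (dpart f X i j)) / 2| +
    2 * `|dpart f X i j - P (c i) (c j)|.
  move=> _; rewrite !mxE; have := tanhR_lipschitz (dpart f X i j) (P (c i) (c j)).
  set a := tanhR _; set b := tanhR _ => Hab.
  rewrite (_ : _ - _ = (X i j - (1 + a) / 2) + (a - b) / 2); last by field.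
  apply: le_trans (ler_normD _ _) _; rewrite lerD2l normrM.
  by rewrite [`|2^-1|]ger0_norm ?invr_ge0 //; lra.
rewrite /l1pairs; apply: le_trans (ler_sum _ (fun i _ => ler_sum _ (pt i))) _.
under eq_bigr do rewrite big_split -mulr_sumr /=.
rewrite big_split -mulr_sumr /= addrC lerD //.
have n4 : (N * N)%:R <= 4 * nN R N :> R.
  rewrite /nN -natrM ler_nat; have := bin_ffact N 2.
  by rewrite ffactnS ffactn1; case: N N2 {X X01 HX c HP f pt} => // N; rewrite /= !factS fact0; lia.
have := ler_wpM2l (ltW d8) n4; lra.
Qed.
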